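(* There exists an ordering (partially ordered set) $\mathbb{P}$ which is $\sigma$-finite cc but not $\sigma$-bounded cc.
   Context: For an ordering $\mathbb{P}$, two elements $p,q$ are orthogonal (incompatible) if there is no $r\in\mathbb{P}$ with $r\le p$ and $r\le q$; an antichain is a set of pairwise orthogonal elements. For a cardinal $\kappa$, a subset $Q\subseteq\mathbb{P}$ has the $\kappa$-cc ($\kappa$-chain condition) if $Q$ contains no antichain (of $\mathbb{P}$) of cardinality $\kappa$. The ordering $\mathbb{P}$ is $\sigma$-bounded cc if $\mathbb{P}=\bigcup_{n\in\omega}P_n$ where each $P_n$ has the $(n+2)$-cc (i.e. contains no antichain with $n+2$ elements). It is $\sigma$-finite cc if $\mathbb{P}=\bigcup_{n\in\omega}P_n$ where each $P_n$ has the $\omega$-cc (i.e. contains no infinite antichain). *)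

(* Defs.v *)
From mathcomp Require Import all_boot all_order.
From mathcomp Require Import boolp classical_sets functions cardinality.

Set Implicit Arguments.
Unset Strict Implicit.
Unset Printing Implicit Defensive.

Local Open Scope classical_set_scope.
Local Open Scope card_scope.
Local Open Scope order_scope.

(* Incompatibility in the forcing sense; not to be confused with the
   incomparability relation [x >< y] of MathComp orders. *)
Definition orthogonal d (P : porderType d) (p q : P) : Prop :=
  ~ exists r : P, r <= p /\ r <= q.

Definition antichain d (P : porderType d) (A : set P) : Prop :=
  forall p q, A p -> A q -> p <> q -> orthogonal p q.

(* The cardinal kappa is represented by an arbitrary set K of that cardinality.
   Orthogonality is computed in the whole of P, not in the subset Q. *)
Definition chain_condition d (P : porderType d) U (K : set U) (Q : set P) :
    Prop :=
  ~ exists A : set P, [/\ A `<=` Q, antichain A & A #= K].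

(* `I_n is the set of natural numbers less than n. *)
Definition sigma_bounded_cc d (P : porderType d) : Prop :=
  exists F : nat -> set P,
    \bigcup_n F n = [set: P] /\ forall n, chain_condition `I_n.+2 (F n).

Definition sigma_finite_cc d (P : porderType d) : Prop :=
  exists F : nat -> set P,
    \bigcup_n F n = [set: P] /\ forall n, chain_condition [set: nat] (F n).

(* Main.v *)
(* Well-order the Cantor space and, on its square X, let (x, s) see
   (y, r) when x < y and r < s.  No infinite sequence of X has all its pairs
   related, in either direction, since it would yield an infinite descent; but
   a pigeonhole on an uncountable set whose initial segments are countable shows
   that every countable colouring of X has monochromatic chains x_0, ..., x_m of
   any length in which each point sees all later ones.
   A condition, in the style of Todorcevic orderings, is a finite set of limits
   together with a set clustering only at these limits, in the topology of the
   Cantor space, through points that see the limit.  Two conditions are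
   orthogonal iff a limit of one lies in the body of the other.  Fixing a length
   of prefixes that separates the limits, and the prefixes of the limits, gives
   countably many pieces; along an infinite antichain in one piece the
   limits with equal prefixes would contradict Dickson's lemma.  Conversely, in
   any countable decomposition, a fusion argument assigns to each point a piece
   in which one can find conditions with this limit and with any prescribed
   finite set of sufficiently close points seeing it in the body, so that a
   monochromatic chain of points produces an antichain of the same size. *)
Require Import Defs.
From mathcomp Require Import all_boot all_order.
From HB Require Import structures.
From mathcomp Require Import boolp classical_sets functions cardinality wochoice.

Set Implicit Arguments.
Unset Strict Implicit.
Unset Printing Implicit Defensive.

Local Open Scope classical_set_scope.

(** * Well-orders and monotone subsequences *)

Section WellOrder.
Context (T : eqType) (R : rel T) (Rwo : well_order R).

Lemma well_order_min (A : set T) :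
  A !=set0 -> exists2 z, A z & forall x, A x -> R z x.
Proof.
case=> a Aa; have [|z [[zA lbz] _]] := Rwo (A := [pred x | `[< A x >]]).
  by exists a; apply/asboolP.
exists z; first exact/asboolP.
by move=> x Ax; apply: lbz; apply/asboolP.
Qed.

Lemma well_order_total : total R.
Proof.
move=> x y; have [|m mE lbm] := @well_order_min [set u | u = x \/ u = y].
  by exists x; left.
by case: mE => <-; rewrite lbm ?orbT //; [right|left].
Qed.

Lemma well_order_refl : reflexive R.
Proof. by move=> x; have := well_order_total x x; rewrite orbb. Qed.

Lemma well_order_anti x y : R x y -> R y x -> x = y.
Proof.
have wo_all : wo_chain R T by move=> A _; exact: Rwo.
by move=> xy yx; apply: (wo_chain_antisymmetric wo_all) => //; rewrite xy yx.
Qed.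

Lemma well_order_trans : transitive R.
Proof.
move=> y x z xy yz.
have [|m mP lbm] := @well_order_min [set u | u \in [:: x; y; z]].
  by exists x; rewrite /= inE eqxx.
have [mx my mz] : [/\ R m x, R m y & R m z].
  by split; apply: lbm; rewrite /= !inE eqxx ?orbT.
move: mP => /=; rewrite !inE => /or3P[] /eqP mE.
- by rewrite -mE.
- by rewrite (well_order_anti xy (_ : R y x)) // -mE.
- by rewrite -(well_order_anti yz (_ : R z y)) // -mE.
Qed.

(** Jump repeatedly to an index at which [f] is minimal over the remaining tail. *)
Lemma monotone_subsequence (f : nat -> T) : exists g : nat -> nat,
  {homo g : i j / i < j} /\ forall i j, i <= j -> R (f (g i)) (f (g j)).
Proof.
have /choice[nxt nxtP] m : exists n, m <= n /\ forall n', m <= n' -> R (f n) (f n').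
  have [|_ [n mn <-] lb] := @well_order_min (f @` [set n | m <= n]).
    by exists (f m); exists m => /=.
  by exists n; split=> // n' mn'; apply: lb; exists n'.
pose g := fix g i := if i is i'.+1 then nxt (g i').+1 else nxt 0.
have gS i : g i < g i.+1 by have [] := nxtP (g i).+1.
have ghom : {homo g : i j / i < j} by apply: homo_ltn => //; exact: ltn_trans.
exists g; split=> // i j; rewrite leq_eqVlt => /orP[/eqP->|ij].
  exact: well_order_refl.
case: i ij => [|i] ij; first by have [_] := nxtP 0; apply.
by have [_] := nxtP (g i).+1; apply; apply: ghom; apply: ltn_trans ij.
Qed.

(* Dickson's lemma. *)
Lemma monotone_subsequences (I : eqType) (s : seq I) (f : I -> nat -> T) :
  exists g : nat -> nat, {homo g : i j / i < j} /\
    forall t, t \in s -> forall i j, i <= j -> R (f t (g i)) (f t (g j)).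
Proof.
elim: s => [|t s [g [ghom gP]]]; first by exists id; split.
have [h [hhom hP]] := monotone_subsequence (f t \o g).
exists (g \o h); split=> [i j ij /=|u]; first by apply/ghom/hhom.
rewrite inE => /predU1P[-> //|us] i j ij; apply: gP => //.
by move: ij; rewrite leq_eqVlt => /predU1P[-> //|/hhom/ltnW].
Qed.

End WellOrder.

Lemma finite_uniform_bound (T : Type) (A : set T) (Q : T -> nat -> Prop) :
    finite_set A ->
    (forall x k k', Q x k -> k <= k' -> Q x k') ->
    (forall x, A x -> exists k, Q x k) ->
  exists k, forall x, A x -> Q x k.
Proof.
elim/Pchoice: T => T in A Q *; move=> /finite_seqP[s ->] Qmon.
elim: s => [|x s IH] Qs; first by exists 0.
have [k kP] := Qs x (mem_head _ _).
have [|l lP] := IH; first by move=> y ys; apply: Qs; rewrite /= inE ys orbT.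
exists (maxn k l) => y /=; rewrite inE => /predU1P[->|ys].
  exact: Qmon kP (leq_maxl _ _).
exact: Qmon (lP _ ys) (leq_maxr _ _).
Qed.

(** * The square of the Cantor space *)

Definition bits := nat -> bool.

(** Cantor's diagonal argument, against an injection into [nat]. *)
Lemma uncountable_bits : ~ countable [set: bits].
Proof.
move=> /countable_injP[f finj].
pose d n := ~~ `[< exists g : bits, f g = n /\ g n >].
case dE: (d (f d)).
  by move: (dE); rewrite /d => /asboolP; apply; exists d.
move: (dE); rewrite /d => /negbFE/asboolP[g [fg gd]].
have gE : g = d by apply: finj; rewrite ?inE.
by move: gd; rewrite gE dE.
Qed.

Definition wo : rel bits := sval (well_ordering_principle bits).

Lemma woP : well_order wo.
Proof. exact: svalP (well_ordering_principle bits). Qed.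

Definition point := (bits * bits)%type.

(** Since [wo] is total, its negation is the strict order reversed: the first coordinate rises and
    the second falls. *)
Definition sees (x y : point) := ~~ wo y.1 x.1 && ~~ wo x.2 y.2.

Lemma sees_irr x : ~ sees x x.
Proof. by rewrite /sees well_order_refl //; exact: woP. Qed.

Definition prefix k (x : point) := (mkseq x.1 k, mkseq x.2 k).

Lemma prefixP k x y :
  prefix k x = prefix k y <-> forall i, i < k -> x.1 i = y.1 i /\ x.2 i = y.2 i.
Proof.
split=> [[e1 e2] i ik|e].
  by split; rewrite -[LHS](nth_mkseq false _ ik) ?e1 ?e2 nth_mkseq.
congr pair; apply/eq_in_map => i; rewrite mem_iota => /andP[_ ik].
  by have [] := e i ik.
by have [] := e i ik.
Qed.

Lemma prefix_le k k' x y : k <= k' -> prefix k' x = prefix k' y -> prefix k x = prefix k y.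
Proof.
by move=> kk' /prefixP e; apply/prefixP => i ik; apply: e; apply: leq_trans kk'.
Qed.

Lemma prefix_separates x y : x <> y -> exists k, prefix k x <> prefix k y.
Proof.
move=> xy; apply: contrapT => /forallNP e; apply: xy.
case: x y e => [x1 x2] [y1 y2] e.
have {}e i : x1 i = y1 i /\ x2 i = y2 i.
  by have /contrapT/prefixP/(_ i (ltnSn i)) := e i.+1.
by congr pair; apply/funext => i; have [] := e i.
Qed.

(** * The ordering of conditions *)

(** In [body_conv], the case [a = y] allows isolated body points. At a limit, disjointness excludes
    it, so every body point close enough sees the limit. *)
Record cond := Cond {
  lim : set point;
  body : set point;
  finite_lim : finite_set lim;
  lim_body_disjoint : forall x, lim x -> ~ body x;
  body_conv : forall y, exists k, forall a, body a -> prefix k a = prefix k y ->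
    a = y \/ (sees a y /\ lim y) }.

Lemma cond_ext p q : lim p = lim q -> body p = body q -> p = q.
Proof.
case: p q => [F A f1 f2 f3] [G B g1 g2 g3] /= FG AB; subst.
by congr Cond; exact: Prop_irrelevance.
Qed.

Definition cond_le (p q : cond) := `[< lim q `<=` lim p /\ body q `<=` body p >].

Lemma cond_le_refl : reflexive cond_le.
Proof. by move=> p; apply/asboolP; split. Qed.

Lemma cond_le_anti : antisymmetric cond_le.
Proof.
move=> p q /andP[/asboolP[l1 b1] /asboolP[l2 b2]].
by apply: cond_ext; apply/seteqP.
Qed.

Lemma cond_le_trans : transitive cond_le.
Proof.
move=> q p r /asboolP[l1 b1] /asboolP[l2 b2]; apply/asboolP.
by split; [exact: subset_trans l2 l1|exact: subset_trans b2 b1].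
Qed.

HB.instance Definition _ := gen_eqMixin cond.
HB.instance Definition _ := gen_choiceMixin cond.
Definition cond0 : cond := Cond (finite_set0 _)
  (fun x (h : set0 x) => False_ind _ h)
  (fun y => ex_intro _ 0 (fun a (h : set0 a) _ => False_ind _ h)).

HB.instance Definition _ := isPointed.Build cond cond0.
HB.instance Definition _ := @Order.Le_isPOrder.Build (Order.Disp tt tt) cond
  cond_le cond_le_refl cond_le_anti cond_le_trans.

(** Finiteness of the limits and [body_conv] pass to unions, so the union of two conditions can only
    fail to be a condition through disjointness. *)
Lemma orthogonalP (p q : cond) :
  orthogonal p q <-> exists x, (lim p x /\ body q x) \/ (lim q x /\ body p x).
Proof.
split=> [pq|[x xP] [r [/asboolP[lp bp] /asboolP[lq bq]]]]; last first.
  by case: xP => -[l b]; apply: (@lim_body_disjoint r x); [apply: lp|apply: bq|apply: lq|apply: bp].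
apply: contrapT => /forallNP nx; apply: pq.
have disj x : (lim p `|` lim q) x -> ~ (body p `|` body q) x.
  move=> [lx|lx] [bx|bx].
  - exact: (@lim_body_disjoint p x).
  - by apply: (nx x); left.
  - by apply: (nx x); right.
  - exact: (@lim_body_disjoint q x).
have conv y : exists k, forall a, (body p `|` body q) a ->
    prefix k a = prefix k y -> a = y \/ (sees a y /\ (lim p `|` lim q) y).
  have [k kP] := body_conv p y; have [l lP] := body_conv q y.
  exists (maxn k l) => a [ba|ba] e.
    have := kP a ba (prefix_le (leq_maxl _ _) e).
    by move=> [|[? ?]]; [left|right; split=> //; left].
  have := lP a ba (prefix_le (leq_maxr _ _) e).
  by move=> [|[? ?]]; [left|right; split=> //; right].
have fin : finite_set (lim p `|` lim q) by rewrite finite_setU; split; exact: finite_lim.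
exists (Cond fin disj conv); split; apply/asboolP; split=> x /=; by [left|right].
Qed.

(** * The ordering is sigma-finite cc *)

Definition piece (k : nat) (S : seq (seq bool * seq bool)) : set cond :=
  [set p | [/\ prefix k @` lim p = [set` S],
    forall x y, lim p x -> lim p y -> prefix k x = prefix k y -> x = y &
    forall a y, body p a -> lim p y -> prefix k a = prefix k y -> sees a y]].

Lemma piece_cover p : exists k S, piece k S p.
Proof.
have [k1 k1P] : exists k, forall u, (lim p `*` lim p) u ->
    prefix k u.1 = prefix k u.2 -> u.1 = u.2.
  apply: (finite_uniform_bound (Q := fun u k => prefix k u.1 = prefix k u.2 -> u.1 = u.2)).
  - by apply: finite_setX; exact: finite_lim.
  - by move=> u k k' Q kk' /(prefix_le kk')/Q.
  - move=> u _; have [->|/eqP/prefix_separates[k kP]] := eqVneq u.1 u.2; first by exists 0.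
    by exists k => /kP.
have [k2 k2P] : exists k, forall y, lim p y ->
    forall a, body p a -> prefix k a = prefix k y -> sees a y.
  apply: (finite_uniform_bound (Q := fun y k => forall a, body p a ->
      prefix k a = prefix k y -> sees a y)).
  - exact: finite_lim.
  - by move=> u k k' Q kk' a ba /(prefix_le kk')/(Q a ba).
  - move=> y ly; have [k kP] := body_conv p y; exists k => a ba e.
    by case: (kP a ba e) => [ay|[]//]; case: (lim_body_disjoint ly); rewrite -ay.
have /finite_seqP[S SE] := finite_image (prefix (maxn k1 k2)) (finite_lim p).
exists (maxn k1 k2), S; split=> //.
  by move=> x y lx ly /(prefix_le (leq_maxl _ _)); apply: (k1P (x, y)).
by move=> a y ba ly /(prefix_le (leq_maxr _ _)); apply: k2P.
Qed.

Lemma piece_finite_cc k S : chain_condition [set: nat] (piece k S).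
Proof.
move=> [A [AP anti]]; rewrite card_eq_le => /andP[_ /pcard_leP/unsquash p].
have pinj m n : p m = p n -> m = n by apply: inj; rewrite inE.
have pP n : A (p n) by exact: funS.
have pS n := AP _ (pP n).
have /choice[f fP] (u : nat * (seq bool * seq bool)) : exists x,
    u.2 \in S -> lim (p u.1) x /\ prefix k x = u.2.
  case: (boolP (u.2 \in S)) => [uS|_]; last by exists ((fun=> false), (fun=> false)).
  have [e _ _] := pS u.1.
  have : [set` S] u.2 by [].
  by rewrite -e => -[x lx xu]; exists x.
(* Make both coordinates of the limits with prefix [t] weakly increasing, for all [t] in [S] at
   once; [sees] needs one to rise and the other to fall. *)
have [g1 [g1hom g1P]] := monotone_subsequences woP S (fun t n => (f (n, t)).1).
have [g2 [g2hom g2P]] := monotone_subsequences woP S (fun t n => (f (g1 n, t)).2).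
pose g := g1 \o g2.
have nosee i j : i < j -> forall t, t \in S ->
    ~ sees (f (g i, t)) (f (g j, t)) /\ ~ sees (f (g j, t)) (f (g i, t)).
  move=> ij t tS; have h1 := g1P t tS _ _ (ltnW (g2hom _ _ ij)).
  have h2 := g2P t tS _ _ (ltnW ij).
  by rewrite /sees /g /= h1 h2 /= andbF.
(* Such an [x] is the limit of [p m] with its prefix, and the last clause of [piece] makes it see
   the limit of [p n] with the same prefix. *)
have conflict m n x : lim (p m) x -> body (p n) x ->
    exists2 t, t \in S & sees (f (m, t)) (f (n, t)).
  move=> lx bx; have [em im _] := pS m; have [en jn sn] := pS n.
  have tS : prefix k x \in S.
    by have : [set` S] (prefix k x) by rewrite -em; exists x.
  exists (prefix k x) => //.
  have [/= lm xm] := fP (m, prefix k x) tS.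
  have [/= ln xn] := fP (n, prefix k x) tS.
  rewrite (im _ _ lm lx xm).
  by apply: sn => //; rewrite xn.
have g01 : g 0 < g 1 by apply/g1hom/g2hom.
have : orthogonal (p (g 0)) (p (g 1)).
  by apply: anti => // /pinj gE; rewrite gE ltnn in g01.
move=> /orthogonalP[x [[lx bx]|[lx bx]]];
  have [t tS ts] := conflict _ _ _ lx bx; have [] := nosee 0 1 isT t tS; auto.
Qed.

Lemma cond_sigma_finite_cc : sigma_finite_cc cond.
Proof.
exists (fun n => if unpickle n is Some kS then piece kS.1 kS.2 else set0); split.
  apply/seteqP; split=> // p _; have [k [S pS]] := piece_cover p.
  by exists (pickle (k, S)) => //; rewrite pickleK.
move=> n; case: unpickle => [[k S]|]; first exact: piece_finite_cc.
move=> [A [A0 _]]; rewrite card_eq_le => /andP[_ /pcard_leP/unsquash p].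
by have /A0 : A (p 0) by exact: funS.
Qed.

(** * The ordering is not sigma-bounded cc *)

(** If each [n] had a counterexample [t n], these sets would converge to [x], and their union would
    be the body of a condition with limit [x] lying in no [F n]. *)
Lemma fusion (F : nat -> set cond) (x : point) :
    \bigcup_n F n = [set: cond] ->
  exists n, forall t : set point, finite_set t ->
    (forall a, t a -> sees a x /\ prefix n a = prefix n x) ->
    exists p, [/\ F n p, lim p x & t `<=` body p].
Proof.
move=> Fcov; apply: contrapT => /forallNP nF.
have /choice[t tP] n : exists t : set point, [/\ finite_set t,
    forall a, t a -> sees a x /\ prefix n a = prefix n x &
    ~ exists p, [/\ F n p, lim p x & t `<=` body p]].
  have /existsNP[t /not_implyP[t1 /not_implyP[t2 t3]]] := nF n.
  by exists t.
have disj y : [set x] y -> ~ (\bigcup_n t n) y.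
  by move=> -> [n _ tx]; have [_ /(_ _ tx)[/sees_irr]] := tP n.
have conv y : exists k, forall a, (\bigcup_n t n) a ->
    prefix k a = prefix k y -> a = y \/ (sees a y /\ [set x] y).
  have [->|/eqP yx] := eqVneq y x.
    exists 0 => a [n _ ta] _; right; split=> //.
    by have [_ /(_ _ ta)[]] := tP n.
  (* Points of [t n] with [n >= k] agree with [x] up to [k], hence differ from [y] there; finitely
     many points remain to be separated from [y]. *)
  have [k kP] := prefix_separates yx.
  have [l lP] : exists l, forall a, (\bigcup_(n in `I_k) t n) a ->
      prefix l a = prefix l y -> a = y.
    apply: (finite_uniform_bound (Q := fun a l => prefix l a = prefix l y -> a = y)).
    - by apply: bigcup_finite => // n _; have [] := tP n.
    - by move=> a m m' Q mm' /(prefix_le mm')/Q.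
    - move=> a _; have [->|/eqP/prefix_separates[m mP]] := eqVneq a y; first by exists 0.
      by exists m => /mP.
  exists (maxn k l) => a [n _ ta] e; left; apply: lP; last first.
    exact: prefix_le (leq_maxr _ _) e.
  exists n => //=; rewrite ltnNge; apply/negP => kn; apply: kP.
  rewrite -(prefix_le (leq_maxl _ _) e).
  by have [_ /(_ _ ta)[_ /(prefix_le kn)]] := tP n.
(* Some [F n] contains this condition, whose body includes [t n]. *)
pose p := Cond (finite_set1 x) disj conv.
have : (\bigcup_n F n) p by rewrite Fcov.
move=> [n _ Fp]; have [_ _] := tP n; apply; exists p; split=> // a ta.
by exists n.
Qed.

(* The initial segment of order type omega_1. *)
Definition small : set bits := [set b | countable [set a | wo a b]].

(** Otherwise the least [z] outside [small] would have its initial segment inside the countable set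
    [small] plus [z], putting [z] in [small]. *)
Lemma uncountable_small : ~ countable small.
Proof.
move=> cs; have [|z zs zmin] := well_order_min woP (A := ~` small).
  apply: contrapT => /nonemptyPn e; apply: uncountable_bits.
  by rewrite -[X in countable X](setCK) setCT -e setCK.
apply: zs.
apply: (@sub_countable _ _ _ (\bigcup_(i : bool) if i then small else [set z])).
  apply: subset_card_le => a /= az.
  have [sa|] := pselect (small a); first by exists true.
  by move=> /zmin za; exists false => //; apply: (well_order_anti woP az za).
by apply: bigcup_countable => // -[] _ //; exact: countable1.
Qed.

Lemma monochromatic_chain (K : countType) (c : point -> K) :
  exists i, forall m, exists s : seq point,
    [/\ size s = m, all (fun x => c x == i) s & pairwise sees s].
Proof.
have bound y : exists i, forall b, small b ->
    exists r, [/\ small r, ~~ wo r b & c (y, r) = i].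
  (* Otherwise countably many countable initial segments, one per colour, would cover [small]. *)
  apply: contrapT => /forallNP nb.
  have /choice[b bP] i : exists b, small b /\
      forall r, small r -> c (y, r) = i -> wo r b.
    have /existsNP[b /not_implyP[sb /forallNP bP]] := nb i.
    exists b; split=> // r sr cr; apply: contrapT => /negP rb.
    by apply: (bP r).
  apply: uncountable_small.
  apply: (@sub_countable _ _ _ (\bigcup_i [set a | wo a (b i)])).
    by apply: subset_card_le => r sr; exists (c (y, r)) => //; apply: (bP _).2.
  by apply: bigcup_countable => // i _; have [] := bP i.
have [j jP] := choice bound.
have [i infi] : exists i, infinite_set [set y | j y = i].
  apply: contrapT => /forallNP fin; apply: uncountable_bits.
  apply: (@sub_countable _ _ _ (\bigcup_i [set y | j y = i])).
    by apply: subset_card_le => y _; exists (j y).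
  by apply: bigcup_countable => // i _; apply: finite_set_countable; exact: contrapT (fin i).
move/infiniteP/pcard_leP: infi => /unsquash f.
have [g [ghom gmon]] := monotone_subsequence woP f.
have fj n : j (f n) = i by apply: (funS (s := f)).
have flt n : ~~ wo (f (g n.+1)) (f (g n)).
  apply/negP => h; have := well_order_anti woP (gmon n n.+1 (leqnSn n)) h.
  move=> /inj; rewrite !inE => /(_ I I) e.
  by have := ghom n n.+1 (ltnSn n); rewrite e ltnn.
have [b0 sb0] : small !=set0.
  apply: contrapT => /nonemptyPn e; apply: uncountable_small.
  by rewrite e; exact: countable0.
exists i => m.
(* Chains grow at the front: [b] bounds the second coordinates, so that a new head can be chosen
   above [b], with first coordinate [f (g n)]. *)
suff /(_ 0) [s [b [_ ? ? ?]]] : forall n, exists (s : seq point) b, [/\ small b,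
    size s = m, all (fun x => c x == i) s /\
    all (fun x => wo (f (g n)) x.1 && wo x.2 b) s & pairwise sees s].
  by exists s; split=> //; tauto.
elim: m => [|m IH] n; first by exists [::], b0.
have [s [b [sb sm [ci sP] pw]]] := IH n.+1.
have [r [sr rb cr]] := jP (f (g n)) b sb.
have br : wo b r by have := well_order_total woP b r; rewrite (negPf rb) orbF.
exists ((f (g n), r) :: s), r; split=> //=; first by rewrite sm.
  rewrite ci cr fj eqxx !(well_order_refl woP).
  split=> //; apply/allP => x /(allP sP)/andP[x1 x2]; apply/andP; split.
    by apply: (well_order_trans woP) x1; apply: gmon.
  exact: (well_order_trans woP) br.
rewrite pw andbT; apply/allP => x /(allP sP)/andP[x1 x2]; apply/andP; split=> /=.
  apply: contraNN (flt n) => h; exact: (well_order_trans woP) h.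
by apply: contraNN rb => h; exact: (well_order_trans woP) x2.
Qed.

Lemma cond_not_sigma_bounded_cc : ~ sigma_bounded_cc cond.
Proof.
move=> [F [Fcov Fcc]].
have /choice[N NP] x := fusion x Fcov.
(* The prefix is part of the colour so that points of one chain are as close to each other as
   [fusion] demands. *)
have [[n u] chain] := monochromatic_chain (fun x => (N x, prefix (N x) x)).
have [s [sn /allP col pw]] := chain n.+2.
pose x0 : point := (fun=> false, fun=> false).
pose x i := nth x0 s i.
have xcol i : i < n.+2 -> N (x i) = n /\ prefix n (x i) = u.
  rewrite -sn => /(mem_nth x0)/col/eqP[e].
  by rewrite e.
have xsees i j : i < j -> j < n.+2 -> sees (x i) (x j).
  move=> ij jn; apply: (pairwiseP x0 pw) => //; rewrite inE sn //.
  exact: ltn_trans jn.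
have /choice[p pP] j : exists p, j < n.+2 ->
    [/\ F n p, lim p (x j) & forall i, i < j -> body p (x i)].
  have [jn|_] := boolP (j < n.+2); last by exists cond0.
  have [Nj pj] := xcol j jn.
  have [|a [i ij <-]|p [Fp lp tp]] := NP (x j) (x @` `I_j).
  - exact: finite_image.
  - have [_ pi] := xcol i (ltn_trans ij jn).
    by rewrite Nj pj pi; split=> //; exact: xsees.
  - exists p => _; split=> //; first by rewrite -Nj.
    by move=> i ij; apply: tp; exists i.
have porth i j : i < j -> j < n.+2 -> orthogonal (p i) (p j).
  move=> ij jn; apply/orthogonalP; exists (x i); left.
  have [_ li _] := pP i (ltn_trans ij jn); have [_ _ bj] := pP j jn.
  by split=> //; exact: bj.
apply: (Fcc n); exists (p @` `I_n.+2); split.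
- by move=> _ [i /= /pP[Fi _ _] <-].
- move=> _ _ [i /= ilt <-] [j /= jlt <-] ne.
  have [ij|ji|ij] := ltngtP i j; first exact: porth.
    by have := porth _ _ ji ilt; move=> o [r [r1 r2]]; apply: o; exists r.
  by rewrite ij in ne.
- apply: inj_card_eq => i j; rewrite !inE /= => ilt jlt e.
  have irr q : ~ orthogonal q q.
    by move=> o; apply: o; exists q; split; exact: Order.POrderTheory.lexx.
  have [ij|ji|//] := ltngtP i j.
    by have := porth _ _ ij jlt; rewrite e => /irr.
  by have := porth _ _ ji ilt; rewrite e => /irr.
Qed.

Theorem mainTheorem1 :
  exists (d : Order.disp_t) (P : porderType d),
    sigma_finite_cc P /\ ~ sigma_bounded_cc P.
Proof.
exists (Order.Disp tt tt), cond.
split; [exact: cond_sigma_finite_cc | exact: cond_not_sigma_bounded_cc].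
Qed.
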